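(* Let $V_{\mathbb{R}}$ be a real Banach space with complexification $V_{\mathbb{C}}=V_{\mathbb{R}}\oplus iV_{\mathbb{R}}$, let $\mathcal{C}_{\mathbb{R}}\subset V_{\mathbb{R}}$ be a closed proper convex cone containing at least two linearly independent vectors, and let $\mathcal{C}_{\mathbb{C}}\subset V_{\mathbb{C}}$ be its canonical complexification. Let $P:V_{\mathbb{R}}\to V_{\mathbb{R}}$ be a real linear operator mapping $\mathcal{C}_{\mathbb{R}}\setminus\{0\}$ into itself. (i) The inclusion $(\mathcal{C}_{\mathbb{R}}\setminus\{0\},h_{\mathcal{C}_{\mathbb{R}}})\hookrightarrow(\mathcal{C}_{\mathbb{C}}\setminus\{0\},\delta_{\mathcal{C}_{\mathbb{C}}})$ is an isometric embedding, where $h_{\mathcal{C}_{\mathbb{R}}}$ is the Hilbert metric of $\mathcal{C}_{\mathbb{R}}$ and $\delta_{\mathcal{C}_{\mathbb{C}}}$ is the projective metric of the complex cone $\mathcal{C}_{\mathbb{C}}\setminus\{0\}$. (ii) The natural (complex linear) extension of $P$ to $V_{\mathbb{C}}$ maps $\mathcal{C}_{\mathbb{C}}\setminus\{0\}$ into itself. If $\Delta_{\mathbb{R}}$ denotes the diameter of $P(\mathcal{C}_{\mathbb{R}}\setminus\{0\})$ for $h_{\mathcal{C}_{\mathbb{R}}}$ and $\Delta_{\mathbb{C}}$ the diameter of $P(\mathcal{C}_{\mathbb{C}}\setminus\{0\})$ for $\delta_{\mathcal{C}_{\mathbb{C}}}$, then $\Delta_{\mathbb{C}}\le 3\Delta_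{\mathbb{R}}$.
   Context: A real convex cone $\mathcal{C}_{\mathbb{R}}$ (closed under addition and multiplication by nonnegative reals) is proper if $\mathcal{C}_{\mathbb{R}}\cap(-\mathcal{C}_{\mathbb{R}})=\{0\}$. Its dual cone $\mathcal{C}_{\mathbb{R}}'$ is the set of continuous real linear functionals on $V_{\mathbb{R}}$ that are $\ge0$ on $\mathcal{C}_{\mathbb{R}}$; such functionals are extended complex-linearly to $V_{\mathbb{C}}$. The canonical complexification is $$\mathcal{C}_{\mathbb{C}}=\{x\in V_{\mathbb{C}}:\ \Re(\langle l_1,x\rangle\overline{\langle l_2,x\rangle})\ge0\ \ \forall l_1,l_2\in\mathcal{C}_{\mathbb{R}}'\}$$ (equivalently $\mathcal{C}_{\mathbb{C}}=\mathbb{C}^*(\mathcal{C}_{\mathbb{R}}+i\mathcal{C}_{\mathbb{R}})$). Hilbert metric: for $x,y\in\mathcal{C}_{\mathbb{R}}\setminus\{0\}$, $h_{\mathcal{C}_{\mathbb{R}}}(x,y)=\log(\beta/\alpha)\in[0,\infty]$ with $\beta=\inf\{t>0:tx-y\in\mathcal{C}_{\mathbb{R}}\}$ and $\alpha=\sup\{t\ge0:y-tx\in\mathcal{C}_{\mathbb{R}}\}$ ($\inf\emptyset=\infty$; the value is $\infty$ if $\beta=\infty$ or $\alpha=0$). Projective metric: for $\mathcal{C}=\mathcal{C}_{\mathbb{C}}\setminus\{0\}$ and $x,y\in\mathcal{C}$, let $E_{\mathcal{C}}(x,y)=\{z\in\mathbb{C}:zx-y\notin\mathcal{C}\}$ and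 $\delta_{\mathcal{C}_{\mathbb{C}}}(x,y)=\delta_{\mathcal{C}}(x,y)=\log(b/a)\in[0,\infty]$, where $b$ and $a$ are the supremum and infimum of $|z|$ over $z\in E_{\mathcal{C}}(x,y)$ (value $\infty$ if $b=\infty$ or $a=0$). Both metrics are projective (zero distance between collinear vectors) and may take the value $\infty$. *)

(* Defs.v *)
From HB Require Import structures.
From mathcomp Require Import all_boot all_order all_algebra.
From mathcomp Require Import complex.
From mathcomp Require Import all_classical all_reals all_analysis.

Set Implicit Arguments.
Unset Strict Implicit.
Unset Printing Implicit Defensive.
Import Order.TTheory GRing.Theory Num.Theory.
Import numFieldNormedType.Exports.

Local Open Scope classical_set_scope.
Local Open Scope ring_scope.

(* The pair (u, v) stands for u + i v.  This is an alias rather than V * V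
   itself, so that it carries the scaling by R[i] and not the componentwise
   one by R. *)
Definition complexification (V : Type) : Type := (V * V)%type.

Section ComplexificationModule.
Variables (R : rcfType) (V : lmodType R).
Local Notation VC := (complexification V).

HB.instance Definition _ := GRing.Zmodule.copy VC (V * V)%type.

Definition complexification_scale (z : R[i]) (x : VC) : VC :=
  (complex.Re z *: x.1 - complex.Im z *: x.2,
   complex.Re z *: x.2 + complex.Im z *: x.1).

Lemma complexification_scaleA (a b : R[i]) (x : VC) :
  complexification_scale a (complexification_scale b x) =
  complexification_scale (a * b) x.
Proof.
case: a b x => [a a'] [b b'] [u v]; rewrite /complexification_scale /=.
congr pair; rewrite !(scalerBr, scalerDr, scalerBl, scalerDl) !scalerA
  ?opprD !addrA addrAC.
  by congr (_ - _); rewrite addrAC.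
by congr (_ + _); rewrite addrAC.
Qed.

Lemma complexification_scale1 : left_id (1 : R[i]) complexification_scale.
Proof.
by case=> u v; rewrite /complexification_scale /= !scale1r !scale0r subr0 addr0.
Qed.

Lemma complexification_scaleDr :
  right_distributive complexification_scale (@GRing.add VC).
Proof.
case=> [a b] [u v] [u' v']; rewrite /complexification_scale /=.
by congr pair; rewrite ?scalerDr ?scalerDl ?opprD addrACA.
Qed.

Lemma complexification_scaleDl (x : VC) :
  {morph complexification_scale^~ x : a b / a + b}.
Proof.
case: x => u v [a a'] [b b']; rewrite /complexification_scale /=.
by congr pair; rewrite !scalerDl ?opprD addrACA.
Qed.

HB.instance Definition _ := GRing.Zmodule_isLmodule.Build R[i] VC
  complexification_scaleA complexification_scale1
  complexification_scaleDr complexification_scaleDl.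

Definition complexification_incl (x : V) : VC := (x, 0).

Definition scalar_ext (l : {scalar V}) (x : VC) : R[i] :=
  Complex (l x.1) (l x.2).

Definition linear_ext (P : {linear V -> V}) (x : VC) : VC := (P x.1, P x.2).

Lemma scalar_ext_is_scalar (l : {scalar V}) : scalar (scalar_ext l).
Proof.
case=> [a b] [u v] [u' v']; rewrite /scalar_ext /=.
rewrite !raddfD /= raddfN /= !linearZ /= scalerN.
by congr Complex.
Qed.

HB.instance Definition _ (l : {scalar V}) :=
  GRing.isLinear.Build R[i] VC R[i] _ (scalar_ext l) (scalar_ext_is_scalar l).

Lemma linear_ext_is_linear (P : {linear V -> V}) : linear (linear_ext P).
Proof.
case=> [a b] [u v] [u' v']; rewrite /linear_ext /=.
rewrite !raddfD /= raddfN /= !linearZ /= scalerN.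
by congr pair.
Qed.

HB.instance Definition _ (P : {linear V -> V}) :=
  GRing.isLinear.Build R[i] VC VC _ (linear_ext P) (linear_ext_is_linear P).

End ComplexificationModule.

Section Cones.
Variables (R : realType) (V : completeNormedModType R).
Implicit Type C : set V.

Definition convex_cone C : Prop :=
  (forall x y, C x -> C y -> C (x + y)) /\
  (forall (t : R) x, 0 <= t -> C x -> C (t *: x)).

Definition proper_cone C : Prop := C `&` [set - x | x in C] = [set 0].

Definition has_two_independent C : Prop :=
  exists u v : V, [/\ C u, C v &
    forall a b : R, a *: u + b *: v = 0 -> a = 0 /\ b = 0].

Definition dual_cone C : set {scalar V} :=
  [set l | continuous (l : V -> R) /\ forall x, C x -> 0 <= l x].

Definition canonical_complexification C : set (complexification V) :=
  [set x | forall l1 l2, dual_cone C l1 -> dual_cone C l2 ->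
    0 <= complex.Re (scalar_ext l1 x * (scalar_ext l2 x)^*%C)].

End Cones.

Section Metrics.
Local Open Scope ereal_scope.

Definition log_ratio (R : realType) (b a : \bar R) : \bar R :=
  if (b == +oo) || (a == 0) then +oo else lne (b / a).

Definition hilbert_metric (R : realType) (V : completeNormedModType R)
    (C : set V) (x y : V) : \bar R :=
  log_ratio
    (ereal_inf [set t%:E | t in [set t : R | (0 < t)%R /\ C (t *: x - y)%R]])
    (ereal_sup [set t%:E | t in [set t : R | (0 <= t)%R /\ C (y - t *: x)%R]]).

(* For D the punctured complexification of a closed proper cone and x, y in D,
   this set is nonempty, so the supremum and infimum of moduli below do not
   take their default values. *)
Definition exceptional_set (R : realType) (W : lmodType R[i]) (D : set W)
    (x y : W) : set R[i] :=
  [set z | ~ D (z *: x - y)%R].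

(* The modulus in R[i] is R[i]-valued with zero imaginary part. *)
Definition projective_metric (R : realType) (W : lmodType R[i]) (D : set W)
    (x y : W) : \bar R :=
  let moduli :=
    [set (complex.Re `|z|%R)%:E | z in exceptional_set D x y] in
  log_ratio (ereal_sup moduli) (ereal_inf moduli).

Definition diameter (R : realType) (T : Type) (d : T -> T -> \bar R)
    (A : set T) : \bar R :=
  ereal_sup [set d x y | x in A & y in A].

Definition isometric_embedding (R : realType) (T U : Type)
    (A : set T) (dA : T -> T -> \bar R) (B : set U) (dB : U -> U -> \bar R)
    (f : T -> U) : Prop :=
  [/\ (forall x, A x -> B (f x)),
      (forall x y, A x -> A y -> f x = f y -> x = y) &
      (forall x y, A x -> A y -> dB (f x) (f y) = dA x y)].

End Metrics.

(* Main.v *)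
(* Everything rests on functionals [f = l1 + mu l2] with [l1], [l2] in the dual
   cone and [Re mu >= 0]: on the real cone they satisfy
   [Re (f u * conj (f v)) >= 0], so if [b - s a] and [t a - b] lie in the cone
   then [f b / f a] lies in the disc with diameter [s, t].

   For real [x], [y] the exceptional set is the disc whose diameter is the
   Hilbert interval [alpha, beta] of [x] and [y], which gives the isometry.

   For the contraction bound, a vector [w] outside the complex cone is
   annihilated by such an [f], so every exceptional [z] for [p], [q] in the image
   of [P] is a quotient [f q / f p].  Up to complex factors [p] and [q] are of the
   form [a + i b] with [a], [b] in the image of the real cone (no continuity of
   [P] is involved), and [f q / f p] factors as
   [(f q / f a') (f a' / f a) (f a / f p)] with [a], [a'] real; each factor is
   confined to an annulus of ratio [exp Delta_R] that does not depend on [f]. *)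

Require Import Defs.
From HB Require Import structures.
From mathcomp Require Import all_boot all_order all_algebra.
From mathcomp Require Import complex.
From mathcomp Require Import all_classical all_reals all_analysis.
From mathcomp Require Import ring lra.

Import Order.TTheory GRing.Theory Num.Theory.
Import numFieldNormedType.Exports.
Local Open Scope classical_set_scope.
Local Open Scope ring_scope.

Set Implicit Arguments.
Unset Strict Implicit.
Unset Printing Implicit Defensive.

(** * Separation of a point from a closed convex cone, by Hahn-Banach *)

Section Separation.
Variables (R : realType) (V : completeNormedModType R) (C : set V).
Hypotheses (C_cone : convex_cone C) (C0 : C 0).

(* Partial linear functionals dominated by the distance to [- C], coded by
   their graphs; domination forces such a graph to be single-valued. *)
Definition dominated_graph (G : set (V * R)) : Prop :=
  (forall (t : R) (g h : V * R), G g -> G h ->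
     G (t *: g.1 + h.1, t * g.2 + h.2)) /\
  (forall (g : V * R) c, G g -> C c -> g.2 <= `|g.1 + c|).

Lemma dominated_graph_uniq G x r s :
  dominated_graph G -> G (x, r) -> G (x, s) -> r = s.
Proof.
move=> [Glin Gdom].
suff le r' s' : G (x, r') -> G (x, s') -> r' <= s'.
  by move=> Gr Gs; apply: le_anti; rewrite !le.
move=> Gr Gs; have := Gdom _ _ (Glin (-1) _ _ Gs Gr) C0.
by rewrite /= scaleN1r addr0 addNr normr0 mulN1r addrC subr_le0.
Qed.

(** The one-dimensional step of Hahn-Banach. A value [r] at [x0] is admissible when [g.2 - |g.1 - x0
    + c| <= r <= |g.1 + x0 + c| - g.2] for all [g] in [G] and [c] in [C]. By the triangle inequality
    and the additivity of [C], each lower bound is below each upper bound, so the supremum [r0] of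
    the lower bounds will do. *)
Lemma dominated_graph_extend G x0 : dominated_graph G -> G (0, 0) ->
  exists2 H, dominated_graph H & G `<=` H /\ exists r, H (x0, r).
Proof.
move=> [Glin Gdom] G0.
pose S := [set y | exists g c, [/\ G g, C c & y = g.2 - `|g.1 - x0 + c|]].
have S0 : S !=set0 by exists (0 - `|0 - x0 + 0|), (0, 0), 0.
have ubS g c : G g -> C c -> ubound S (`|g.1 + x0 + c| - g.2).
  move=> Gg Cc _ [h [d [Gh Cd ->]]].
  have := Gdom _ _ (Glin 1 _ _ Gg Gh) (C_cone.1 _ _ Cc Cd).
  have -> : 1 *: g.1 + h.1 + (c + d) = (g.1 + x0 + c) + (h.1 - x0 + d).
    by rewrite scale1r [RHS]addrACA [g.1 + x0 + _]addrACA subrr addr0.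
  by move: (ler_normD (g.1 + x0 + c) (h.1 - x0 + d)) => /= tri dom; lra.
have supS : has_sup S.
  by split=> //; exists (`|0 + x0 + 0| - 0); exact: (ubS (0, 0)).
pose r0 := sup S.
have r0_ge g c : G g -> C c -> g.2 - r0 <= `|g.1 - x0 + c|.
  move=> Gg Cc; rewrite lerBlDr -lerBlDl; apply: sup_upper_bound => //.
  by exists g, c.
have r0_le g c : G g -> C c -> g.2 + r0 <= `|g.1 + x0 + c|.
  by move=> Gg Cc; rewrite -lerBrDl; apply: ge_sup => //; exact: ubS.
have Gscale t g : G g -> G (t *: g.1, t * g.2).
  by move=> Gg; have := Glin t _ _ Gg G0; rewrite /= !addr0.
exists [set y | exists g t, G g /\ y = (g.1 + t *: x0, g.2 + t * r0)]; last first.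
  split=> [g Gg|]; first by exists g, 0; rewrite scale0r mul0r !addr0 -surjective_pairing.
  by exists r0, (0, 0), 1; rewrite /= scale1r mul1r !add0r.
split=> [t _ _ [g [a [Gg ->]]] [h [b [Gh ->]]]|_ c [g [t [Gg ->]]] Cc] /=.
  exists (t *: g.1 + h.1, t * g.2 + h.2), (t * a + b); split; first exact: Glin.
  by rewrite /= scalerDr mulrDr scalerA mulrA scalerDl mulrDl addrACA [t * _ + _ + _]addrACA.
(* By homogeneity only [t = 1] and [t = -1] matter: dividing by [|t|] reduces domination to [r0_le]
   or [r0_ge]. *)
have [t0|t0|->] := ltgtP t 0; last first.
- by rewrite scale0r mul0r !addr0; exact: Gdom.
- have Cc' : C (t^-1 *: c) by apply: C_cone.2 => //; rewrite invr_ge0 ltW.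
  have := r0_le _ _ (Gscale t^-1 _ Gg) Cc'; rewrite /= => le.
  have := ler_wpM2l (ltW t0) le; rewrite mulrDr mulVKf ?gt_eqF// => /le_trans; apply.
  rewrite -{1}(gtr0_norm t0) -normrZ !scalerDr !scalerA mulfV ?gt_eqF//.
  by rewrite !scale1r.
- have s0 : 0 < - t by rewrite oppr_gt0.
  have Cc' : C ((- t)^-1 *: c) by apply: C_cone.2 => //; rewrite invr_ge0 ltW.
  have := r0_ge _ _ (Gscale (- t)^-1 _ Gg) Cc'; rewrite /= => le.
  have := ler_wpM2l (ltW s0) le; rewrite mulrBr mulVKf ?gt_eqF//.
  rewrite mulNr opprK => /le_trans; apply.
  rewrite -{1}(gtr0_norm s0) -normrZ !scalerDr !scalerA mulfV ?gt_eqF//.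
  by rewrite !scale1r scalerN scaleNr opprK.
Qed.

Lemma dominated_functional_extension G0 : dominated_graph G0 -> G0 (0, 0) ->
  exists2 l : {scalar V}, forall x c, C c -> l x <= `|x + c| &
    forall x r, G0 (x, r) -> l x = r.
Proof.
move=> domG0 G00.
(* Zorn is applied to the sets [H] for which [H] together with [G0] is dominated. The empty chain is
   then harmless: its union [set0] yields [G0] itself. *)
have [F FP totF|A [domA maxA]] :=
    @Zorn_bigcup _ (fun H => dominated_graph (H `|` G0)).
  have common g h : (\bigcup_(X in F) X `|` G0) g ->
      (\bigcup_(X in F) X `|` G0) h ->
      exists X, [/\ dominated_graph (X `|` G0), (X `|` G0) g, (X `|` G0) h &
                    X `<=` \bigcup_(X in F) X].
    move=> [[X FX Xg]|G0g] [[Y FY Yh]|G0h].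
    - have [XY|YX] := totF _ _ FX FY.
      + exists Y; split; [exact: FP|left; exact: XY|by left|exact: bigcup_sup].
      + exists X; split; [exact: FP|by left|left; exact: YX|exact: bigcup_sup].
    - exists X; split; [exact: FP|by left|by right|exact: bigcup_sup].
    - exists Y; split; [exact: FP|by right|by left|exact: bigcup_sup].
    - by exists set0; split; [rewrite set0U|right|right|].
  split=> [t g h /common/[apply] -[X [[Xlin _] Xg Xh XF]]|g c Fg].
    by have := Xlin t _ _ Xg Xh; exact: setSU.
  by have [X [[_ Xdom] Xg _ _]] := common _ _ Fg Fg; exact: Xdom.
have tot x : exists r, (A `|` G0) (x, r).
  have [|H domH [AH [r Hr]]] := dominated_graph_extend x domA; first by right.
  exists r; apply: contrapT => nA; apply: (maxA H); last first.
    by rewrite (setUidl (subset_trans _ AH))//; exact: subsetUr.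
  by split=> [y Ay|/(_ _ Hr) Ar]; [apply: AH|apply: nA]; left.
have [f fA] := choice tot.
have f_lin : scalar f.
  move=> t x y; apply: (dominated_graph_uniq domA (fA _)).
  exact: (domA.1 t _ _ (fA x) (fA y)).
pose flin := GRing.isLinear.Build R V R *%R f f_lin.
pose l : {scalar V} := HB.pack f flin.
exists l => [x c|x r G0x]; first exact: (domA.2 _ c (fA x)).
by apply: (dominated_graph_uniq domA (fA x)); right.
Qed.

(** With [d > 0] a lower bound for the distance from [x0] to [C], the functional [t *: x0 |-> - t d]
    on the line through [x0] is dominated by the distance to [- C]. Its extension [l] is negative at
    [x0], at most [0] on [- C], and bounded by the norm, hence continuous. *)
Lemma cone_separation x0 : closed C -> ~ C x0 ->
  exists2 l, dual_cone C l & l x0 < 0.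
Proof.
move=> Ccl nCx0.
have [d d0 dx0] : exists2 d : R, 0 < d & forall c, C c -> d <= `|x0 - c|.
  have /nbhs_ballP[d /= d0 dC] : nbhs x0 (~` C).
    by apply: open_nbhs_nbhs; split=> //; exact: closed_openC.
  exists d => // c Cc; rewrite leNgt; apply/negP => ltd.
  by apply: (dC c) => //; rewrite -ball_normE.
have nC t c : C c -> - (t * d) <= `|t *: x0 + c|.
  move=> Cc; have [t0|t0] := leP 0 t.
    by rewrite (le_trans _ (normr_ge0 _))// oppr_le0 mulr_ge0// ltW.
  have nt0 : 0 < - t by rewrite oppr_gt0.
  have -> : t *: x0 + c = t *: (x0 - (- t)^-1 *: c).
    by rewrite invrN scaleNr opprK scalerDr scalerA divff ?scale1r// lt_eqF.
  rewrite normrZ ltr0_norm// -mulNr; apply: ler_wpM2l (ltW nt0) _ _ _.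
  by apply: dx0; apply: C_cone.2 => //; rewrite invr_ge0 ltW.
have [||l lle lx0] := @dominated_functional_extension [set g | exists t : R, g = (t *: x0, - (t * d))].
- split=> [t _ _ [a ->] [b ->]|_ c [t ->]]; last exact: nC.
  by exists (t * a + b); congr pair => /=; [rewrite scalerDl scalerA|ring].
- by exists 0; rewrite scale0r mul0r oppr0.
exists l; last by rewrite (lx0 x0 (- d)) ?oppr_lt0//; exists 1; rewrite scale1r mul1r.
have lle1 x : l x <= `|x| by rewrite -[x in leRHS]addr0; exact: lle.
split=> [|c Cc].
  apply: bounded_linear_continuous; apply/bounded_funP => r; exists r => x xr.
  rewrite ler_norml (le_trans (lle1 x))// andbT lerNl -linearN.
  by rewrite (le_trans (lle1 _))// normrN.
by have := lle (- c) _ Cc; rewrite addNr normr0 linearN oppr_le0.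
Qed.

Lemma coneP x : closed C -> C x <-> forall l, dual_cone C l -> 0 <= l x.
Proof.
move=> Ccl; split=> [Cx l [_]|Cx]; first exact.
apply: contrapT => /(cone_separation Ccl)[l /Cx]; rewrite leNgt => /negP.
exact.
Qed.

End Separation.

(** * The real-valued modulus on [R[i]] *)

Section Modulus.
Variable R : realType.
Local Notation modulus z := (complex.Re `|z|).

Lemma Re_mul_conj (z w : R[i]) : complex.Re (z * w^*%C) =
  complex.Re z * complex.Re w + complex.Im z * complex.Im w.
Proof. by case: z w => [a b] [c d] /=; rewrite mulrN opprK. Qed.

Lemma modulusE (z : R[i]) :
  modulus z = Num.sqrt (complex.Re z ^+ 2 + complex.Im z ^+ 2).
Proof. by rewrite normc_def. Qed.

Lemma modulus_ge0 (z : R[i]) : 0 <= modulus z.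
Proof. by rewrite modulusE sqrtr_ge0. Qed.

Lemma modulus_sqr (z : R[i]) :
  modulus z ^+ 2 = complex.Re z ^+ 2 + complex.Im z ^+ 2.
Proof. by rewrite modulusE sqr_sqrtr// addr_ge0// sqr_ge0. Qed.

Lemma modulus_ge_Re (z : R[i]) : complex.Re z <= modulus z.
Proof.
rewrite (le_trans (ler_norm _))// -ler_sqr ?nnegrE ?modulus_ge0//.
by rewrite modulus_sqr real_normK ?num_real// lerDl sqr_ge0.
Qed.

Lemma modulus_real (t : R) : 0 <= t -> modulus (t%:C%C : R[i]) = t.
Proof. by move=> t0; rewrite modulusE /= expr0n addr0 sqrtr_sqr ger0_norm. Qed.

Lemma modulusM (z w : R[i]) : modulus (z * w) = modulus z * modulus w.
Proof. exact: Normc.normcM. Qed.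

Lemma modulusN (z : R[i]) : modulus (- z) = modulus z.
Proof. exact: normcN. Qed.

Lemma ler_modulusD (z w : R[i]) : modulus (z + w) <= modulus z + modulus w.
Proof. exact: le_normcD. Qed.

Lemma modulus_i : modulus ('i%C : R[i]) = 1.
Proof. by rewrite modulusE /= expr0n expr1n add0r sqrtr1. Qed.

Lemma modulus_gt0 (z : R[i]) : (0 < modulus z) = (z != 0).
Proof.
rewrite lt_neqAle modulus_ge0 andbT eq_sym; congr (~~ _).
apply/eqP/eqP => [|->]; first exact: Normc.eq0_normc.
exact: Normc.normc0.
Qed.

(** The squares of the two moduli differ by [4 Re (z * conj w)]. *)
Lemma modulus_subr_le_addr (z w : R[i]) :
  0 <= complex.Re (z * w^*%C) -> modulus (z - w) <= modulus (z + w).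
Proof.
rewrite Re_mul_conj => ge0.
rewrite -ler_sqr ?nnegrE ?modulus_ge0// !modulus_sqr; move: ge0.
by case: z w => [a b] [c d] /=; lra.
Qed.

Lemma modulus_annulus (z w k : R[i]) r : modulus (z - k * w) <= r * modulus w ->
  (modulus k - r) * modulus w <= modulus z <= (modulus k + r) * modulus w.
Proof.
move=> zkw; have := ler_modulusD (z - k * w) (k * w).
have := ler_modulusD z (- (z - k * w)).
by rewrite modulusN opprB addrC subrK subrK modulusM => ? ?; lra.
Qed.

End Modulus.

(** * Structure of the canonical complexification *)

Section ComplexCone.
Variables (R : realType) (V : completeNormedModType R) (C : set V).
Hypotheses (C_closed : closed C) (C_cone : convex_cone C).
Hypothesis C_proper : proper_cone C.
Local Notation CC := (canonical_complexification C).

Lemma proper_cone0 : C 0.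
Proof. by have [] : (C `&` [set - x | x in C]) 0 by rewrite C_proper. Qed.
Hint Resolve proper_cone0 : core.

Lemma proper_cone_eq0 x : C x -> C (- x) -> x = 0.
Proof.
move=> Cx CNx; suff : (C `&` [set - x | x in C]) x by rewrite C_proper.
by split=> //; exists (- x) => //; rewrite opprK.
Qed.

Lemma cone_dualP x : (forall l, dual_cone C l -> 0 <= l x) -> C x.
Proof. exact: (coneP C_cone proper_cone0 x C_closed).2. Qed.

Lemma not_cone_dual x : ~ C x -> exists2 l, dual_cone C l & l x < 0.
Proof. exact: cone_separation. Qed.

Lemma dual_cone_gt0 x : C x -> x <> 0 -> exists2 l, dual_cone C l & 0 < l x.
Proof.
move=> Cx x0; have [l Dl] : exists2 l, dual_cone C l & l (- x) < 0.
  by apply: not_cone_dual => /(proper_cone_eq0 Cx).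
by rewrite linearN oppr_lt0; exists l.
Qed.

Lemma cone_scale_eq0 x t : C x -> x <> 0 -> C (t *: x) -> 0 <= t.
Proof.
move=> /dual_cone_gt0/[apply] -[l [_ Dl] lx] /Dl.
by rewrite linearZ /= pmulr_lge0.
Qed.

Lemma cone_limit u v : (forall e, 0 < e -> C (u + e *: v)) -> C u.
Proof.
move=> lim; apply: cone_dualP => l [_ Dl]; apply/ler_addgt0Pr => e e0.
(* The multiple [e / (|l v| + 1)] of [v] changes [l u] by at most [e]; the added [1] keeps the
   denominator positive. *)
have d0 : 0 < `|l v| + 1 by rewrite ltr_pwDr.
have := Dl _ (lim _ (divr_gt0 e0 d0)).
rewrite linearD linearZ /= => /le_trans; apply; rewrite lerD2l.
rewrite mulrAC ler_pdivrMr// ler_wpM2l ?(ltW e0)// (le_trans (ler_norm _))//.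
by rewrite lerDl.
Qed.

(** The extensions of [l1] and [l2] are both multiplied by [z], so the tested real part is
    multiplied by [|z|^2]. *)
Lemma CC_scale z x : CC x -> CC (z *: x).
Proof.
case: z => a b CCx l1 l2 Dl1 Dl2; have := CCx l1 l2 Dl1 Dl2.
rewrite !Re_mul_conj !linearZ /= => ge0.
set rhs := (X in 0 <= X); suff -> : rhs =
    (a ^+ 2 + b ^+ 2) * (l1 x.1 * l2 x.1 + l1 x.2 * l2 x.2).
  by rewrite mulr_ge0// addr_ge0 ?sqr_ge0.
by rewrite /rhs; ring.
Qed.

Lemma CC_intro u v : C u -> C v -> CC (u, v).
Proof.
move=> Cu Cv l1 l2 [_ D1] [_ D2]; rewrite Re_mul_conj /=.
by rewrite addr_ge0// mulr_ge0// ?D1 ?D2.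
Qed.

(* The vectors [(l u, l v)], [l] in the dual cone, pairwise make angles at most
   [pi / 2], so they all lie in one quadrant. *)
Lemma CC_decomp x : CC x ->
  exists z u v, [/\ z != 0, C u, C v & x = z *: ((u, v) : complexification V)].
Proof.
move=> CCx.
have unscale (z : R[i]) u v : z != 0 -> C u -> C v -> z *: x = (u, v) ->
    exists z u v, [/\ z != 0, C u, C v & x = z *: ((u, v) : complexification V)].
  move=> z0 Cu Cv xE; exists z^-1, u, v; split; rewrite ?invr_eq0// -xE.
  by rewrite scalerA mulVf// scale1r.
have [[l0 D0 l0x]|x0] :=
    pselect (exists2 l, dual_cone C l & scalar_ext l x != 0); last first.
  have lx0 l : dual_cone C l -> l x.1 = 0 /\ l x.2 = 0.
    move=> Dl; have [/eqP|lx] := eqVneq (scalar_ext l x) 0.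
      by rewrite eq_complex => /andP[/eqP ? /eqP].
    by case: x0; exists l.
  by apply: (unscale 1 x.1 x.2); rewrite ?oner_eq0 ?scale1r -?surjective_pairing//;
    apply: cone_dualP => l /lx0[l1 l2]; rewrite ?l1 ?l2.
(* This factor makes [l0 y] real and positive. Pairing any [l] with [l0] then gives [l u >= 0], so
   the real part [u] of [y] is already in [C]; only [v] remains to be corrected. *)
pose z0 := (scalar_ext l0 x)^*%C; pose y := z0 *: x.
have z00 : z0 != 0 by rewrite conjc_eq0.
have CCy : CC y by exact: CC_scale.
have {unscale} unscale (z : R[i]) u v : z != 0 -> C u -> C v -> z *: y = (u, v) ->
    exists z u v, [/\ z != 0, C u, C v & x = z *: ((u, v) : complexification V)].
  by move=> zn0 Cu Cv; rewrite scalerA; apply: unscale; rewrite ?mulf_neq0.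
have l0y : scalar_ext l0 y = z0 * scalar_ext l0 x by rewrite linearZ.
have [u0 v0] : 0 < l0 y.1 /\ l0 y.2 = 0.
  move: l0y l0x; rewrite /z0; case: (scalar_ext l0 x) => p q [-> ->].
  rewrite eq_complex /= negb_and => pq; split; last by ring.
  rewrite mulNr opprK -!expr2; case/orP: pq => n0.
    by rewrite ltr_pwDl ?sqr_ge0// exprn_even_gt0.
  by rewrite ltr_pwDr ?sqr_ge0// exprn_even_gt0.
have dual2 l1 l2 : dual_cone C l1 -> dual_cone C l2 ->
    0 <= l1 y.1 * l2 y.1 + l1 y.2 * l2 y.2.
  by move=> D1 D2; have := CCy _ _ D1 D2; rewrite Re_mul_conj.
case: y CCy {l0y} unscale u0 v0 dual2 => u v /= CCy unscale u0 v0 dual2.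
have lu l : dual_cone C l -> 0 <= l u.
  by move=> Dl; have := dual2 _ _ Dl D0; rewrite v0 mulr0 addr0 pmulr_lge0.
have Cu : C u by exact: cone_dualP.
(* If [- v] is in [C], then [i (u + i v) = - v + i u] has both parts in [C]. *)
have [CNv|CNv] := pselect (C (- v)).
  apply: (unscale 'i%C (- v) u) => //; first by rewrite eq_complex /= oner_eq0 andbF.
  by congr pair; rewrite /= !scale0r !scale1r ?add0r.
have [l2 D2] := not_cone_dual CNv; rewrite linearN oppr_lt0 => l2v.
(* With [tau = sup T], the product [(1 - i tau) (u + i v) = (u + tau v) + i (v - tau u)] has both
   parts in [C]. The second part is in [C] by closedness. For the first, [inT] gives
   [- l u / l v <= tau] when [l v > 0], and [tau <= 0] settles the case [l v <= 0]. *)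
pose T := [set t | C (v - t *: u)].
have ubT : ubound T 0.
  move=> t /= Ct; have := D0.2 _ Ct.
  by rewrite linearB linearZ /= v0 sub0r oppr_ge0 pmulr_lle0.
have inT l : dual_cone C l -> 0 < l v -> T (- (l u / l v)).
  move=> Dl lv; apply: cone_dualP => k Dk; rewrite linearB linearZ /=.
  rewrite -(pmulr_rge0 _ lv) mulrBr mulNr mulrN opprK mulrA mulrCA divff ?gt_eqF//.
  by rewrite mulr1 addrC; exact: dual2.
have supT : has_sup T by split; [exists (- (l2 u / l2 v)); exact: inT|exists 0].
have tau0 : sup T <= 0 by apply: ge_sup => //; case: supT.
apply: (unscale (Complex 1 (- sup T)) (u + sup T *: v) (v - sup T *: u)).
- by rewrite eq_complex /= oner_eq0.
- apply: cone_dualP => l Dl; rewrite linearD linearZ /=.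
  have [lv|lv] := ltP 0 (l v); last first.
    by rewrite addr_ge0 ?lu// mulr_le0.
  have := sup_upper_bound supT (inT _ Dl lv).
  by rewrite lerNl ler_pdivlMr// mulNr -subr_ge0 opprK.
- apply: (@cone_limit _ u) => e e0; have [t Tt lt] := sup_adherent e0 supT.
  have -> : v - sup T *: u + e *: u = (v - t *: u) + (t - (sup T - e)) *: u.
    by rewrite !scalerBl addrA subrK opprB addrA addrAC.
  by apply: C_cone.1 => //; apply: C_cone.2 => //; rewrite subr_ge0 ltW.
- by congr pair; rewrite /= scaleNr scale1r ?opprK.
Qed.

End ComplexCone.

(** * Isometry between the Hilbert metric and the projective metric *)

Lemma ereal_right_dense (R : realType) (r : R) (e : \bar R) :
  (r%:E < e)%E -> exists2 t, r < t & (t%:E < e)%E.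
Proof.
case: e => [s| |]//; rewrite ?lte_fin => rs.
  by exists ((r + s) / 2); rewrite ?lte_fin midf_lt.
by exists (r + 1); rewrite ?ltrDl// ltry.
Qed.

Section HilbertMetric.
Variables (R : realType) (V : completeNormedModType R) (C : set V).
Hypotheses (C_closed : closed C) (C_cone : convex_cone C).
Hypothesis C_proper : proper_cone C.
Local Notation CC := (canonical_complexification C).
Local Notation incl := (@complexification_incl R V).

Section TwoVectors.
Variables x y : V.
Hypotheses (Cx : C x) (x0 : x <> 0) (Cy : C y) (y0 : y <> 0).
Local Notation E := (exceptional_set (CC `\ 0) (incl x) (incl y)).

Lemma incl_collinear z : z *: incl x = incl y -> y = complex.Re `|z| *: x.
Proof.
case: z => a b [] /eqP; rewrite scaler0 subr0 scaler0 add0r => /eqP axy.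
move/eqP; rewrite scaler_eq0 => /orP[/eqP->|/eqP//].
have a0 : 0 <= a by apply: (cone_scale_eq0 C_closed C_cone C_proper Cx x0); rewrite axy.
by rewrite -[Complex a 0]/(a%:C%C) modulus_real.
Qed.

Lemma scalar_ext_incl (l : {scalar V}) z : scalar_ext l (z *: incl x - incl y) =
  Complex (complex.Re z * l x - l y) (complex.Im z * l x).
Proof.
by congr Complex; rewrite /= scaler0 subr0 ?add0r ?linearB linearZ.
Qed.

(** The real part tested for [z] is [|z|^2 l1 x l2 x - Re z (l1 x l2 y + l1 y l2 x) + l1 y l2 y].
    The middle bracket is nonnegative and [Re z <= |z|], so replacing [z] by [|z|] can only lower
    the value: the positive real axis is the worst case. *)
Lemma not_exceptional z : z *: incl x <> incl y ->
  (forall l1 l2, dual_cone C l1 -> dual_cone C l2 ->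
     0 <= (complex.Re `|z| * l1 x - l1 y) * (complex.Re `|z| * l2 x - l2 y)) ->
  ~ E z.
Proof.
move=> zxy ge0; apply; split; last by move=> /= /eqP; rewrite subr_eq0 => /eqP.
move=> l1 l2 D1 D2; rewrite !scalar_ext_incl Re_mul_conj.
have cross : 0 <= l1 x * l2 y + l1 y * l2 x.
  by case: D1 D2 => [_ D1] [_ D2]; rewrite addr_ge0 ?mulr_ge0 ?D1 ?D2.
have aux : 0 <= complex.Re `|z| - complex.Re z by rewrite subr_ge0 modulus_ge_Re.
have := addr_ge0 (ge0 _ _ D1 D2) (mulr_ge0 aux cross).
move: (modulus_sqr z) {ge0 aux}; set m := complex.Re `|z| => m2.
set L := (X in 0 <= X -> _).
have -> : L = m ^+ 2 * (l1 x * l2 x) - complex.Re z * (l1 x * l2 y + l1 y * l2 x)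
    + l1 y * l2 y by rewrite /L; ring.
rewrite m2 /= => le; apply: le_trans le _; rewrite le_eqVlt; apply/orP; left.
by apply/eqP; ring.
Qed.

Lemma exceptional_le z t : 0 < t -> C (t *: x - y) -> E z -> complex.Re `|z| <= t.
Proof.
move=> t0 Ct Ez; rewrite leNgt; apply/negP => tm; apply: not_exceptional Ez.
  move=> /incl_collinear yx; move: Ct; rewrite yx -scalerBl.
  move=> /(cone_scale_eq0 C_closed C_cone C_proper Cx x0).
  by rewrite subr_ge0 leNgt tm.
suff le l : dual_cone C l -> 0 <= complex.Re `|z| * l x - l y.
  by move=> l1 l2 /le l1ge0 /le; exact: mulr_ge0.
move=> [_ Dl]; have := Dl _ Ct; rewrite linearB linearZ /= => /le_trans; apply.
by rewrite lerD2r ler_wpM2r ?Dl// ltW.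
Qed.

Lemma exceptional_ge z t : C (y - t *: x) -> E z -> t <= complex.Re `|z|.
Proof.
move=> Ct Ez; rewrite leNgt; apply/negP => tm; apply: not_exceptional Ez.
  move=> /incl_collinear yx; move: Ct; rewrite yx -scalerBl.
  move=> /(cone_scale_eq0 C_closed C_cone C_proper Cx x0).
  by rewrite subr_ge0 leNgt tm.
suff le l : dual_cone C l -> complex.Re `|z| * l x - l y <= 0.
  by move=> l1 l2 /le l1le0 /le; exact: mulr_le0.
move=> [_ Dl]; have := Dl _ Ct; rewrite linearB linearZ /= subr_ge0 subr_le0.
by apply: le_trans; rewrite ler_wpM2r ?Dl// ltW.
Qed.

(** Separating both [t *: x - y] and its opposite from [C] gives two functionals of opposite strict
    signs at [t *: x - y], whose product is negative. *)
Lemma exceptional_real t : ~ C (t *: x - y) -> ~ C (y - t *: x) -> E t%:C%C.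
Proof.
move=> /(not_cone_dual C_closed C_cone C_proper)[l1 D1 l1x].
move=> /(not_cone_dual C_closed C_cone C_proper)[l2 D2 l2x] [CCt _].
have := CCt l1 l2 D1 D2; rewrite !scalar_ext_incl Re_mul_conj /= !mul0r addr0.
move: l1x; rewrite linearB linearZ /= => l1x.
move: l2x; rewrite linearB linearZ /= => l2x.
by move: l2x; rewrite leNgt nmulr_rlt0// subr_gt0 subr_lt0 => ->.
Qed.

Lemma exceptional_scale t : y = t *: x -> 0 <= t -> E t%:C%C.
Proof.
move=> yx t0 [_]; apply; rewrite yx; congr pair => /=.
  by rewrite scale0r subr0; exact: subrr.
by rewrite scaler0 scale0r addr0; exact: subrr.
Qed.

Lemma cone_upward s t : s <= t -> C (s *: x - y) -> C (t *: x - y).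
Proof.
move=> st Cs; have -> : t *: x - y = (s *: x - y) + (t - s) *: x.
  by rewrite [RHS]addrAC -scalerDl [s + _]addrC subrK.
by apply: C_cone.1 => //; apply: C_cone.2 => //; rewrite subr_ge0.
Qed.

Lemma cone_downward s t : s <= t -> C (y - t *: x) -> C (y - s *: x).
Proof.
move=> st Ct; have -> : y - s *: x = (y - t *: x) + (t - s) *: x.
  by rewrite scalerBl addrA subrK.
by apply: C_cone.1 => //; apply: C_cone.2 => //; rewrite subr_ge0.
Qed.

Lemma cone_le s t : C (y - s *: x) -> C (t *: x - y) -> s <= t.
Proof.
move=> Cs Ct; rewrite -subr_ge0.
apply: (cone_scale_eq0 C_closed C_cone C_proper Cx x0).
by rewrite scalerBl -[t *: x](subrK y) -addrA; exact: C_cone.1.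
Qed.

Lemma cone_upward_closed s : (forall t, s < t -> C (t *: x - y)) -> C (s *: x - y).
Proof.
move=> Ct; apply: (cone_limit C_closed C_cone C_proper (v := x)) => e e0.
by have := Ct (s + e); rewrite ltrDl scalerDl addrAC; exact.
Qed.

Lemma cone_downward_closed s : (forall t, t < s -> C (y - t *: x)) -> C (y - s *: x).
Proof.
move=> Ct; apply: (cone_limit C_closed C_cone C_proper (v := x)) => e e0.
by have := Ct (s - e); rewrite ltrBlDr ltrDl scalerBl opprB addrA addrAC; exact.
Qed.

(** Dividing [y - t *: x] by [t] and letting [t] grow would put [- x] in [C], against properness. *)
Lemma cone_downward_bounded : ~ (forall t, 0 < t -> C (y - t *: x)).
Proof.
move=> Ct; apply: x0; apply: (proper_cone_eq0 C_proper Cx).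
apply: (cone_limit C_closed C_cone C_proper (v := y)) => e e0.
have -> : - x + e *: y = e *: (y - e^-1 *: x).
  by rewrite scalerBr scalerA divff ?gt_eqF// scale1r addrC.
by apply: C_cone.2; [exact: ltW|apply: Ct; rewrite invr_gt0].
Qed.

Lemma cone_eq_scale t : C (t *: x - y) -> C (y - t *: x) -> y = t *: x.
Proof.
move=> C1 C2; apply/eqP; rewrite -subr_eq0; apply/eqP.
by apply: (proper_cone_eq0 C_proper) => //; rewrite opprB.
Qed.

Let upper : set (\bar R) :=
  [set t%:E | t in [set t : R | (0 < t)%R /\ C (t *: x - y)%R]].
Let lower : set (\bar R) :=
  [set t%:E | t in [set t : R | (0 <= t)%R /\ C (y - t *: x)%R]].
Let moduli : set (\bar R) := [set (complex.Re `|z|%R)%:E | z in E].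

Lemma lower_sup :
  exists a, [/\ 0 <= a, ereal_sup lower = a%:E & C (y - a *: x)].
Proof.
have [t [t0 nCt]] : exists t, 0 < t /\ ~ C (y - t *: x).
  by have /existsNP[t /not_implyP] := cone_downward_bounded; exists t.
pose S := [set t : R | (0 <= t)%R /\ C (y - t *: x)%R].
have S0 : S 0 by split=> //; rewrite scale0r subr0.
have Sub : has_ubound S.
  by exists t => s [_ Cs]; rewrite leNgt; apply/negP => /ltW/cone_downward/(_ Cs).
have supS : has_sup S by split=> //; exists 0.
exists (sup S); split; first exact: sup_upper_bound supS _ S0.
  by rewrite -ereal_sup_EFin//; exists 0.
apply: cone_downward_closed => s /(sup_gt supS.1)[u [_ Cu] su].
by apply: cone_downward Cu; exact: ltW.
Qed.

Lemma upper_attained b : ereal_inf upper = b%:E -> C (b *: x - y).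
Proof.
move=> infE; apply: cone_upward_closed => t.
rewrite -lte_fin -infE => /ereal_inf_lt[_ [s [_ Cs] <-]].
by rewrite lte_fin => /ltW st; exact: cone_upward Cs.
Qed.

Lemma moduli_real t : 0 <= t -> E t%:C%C -> moduli t%:E.
Proof. by move=> t0 Et; exists t%:C%C => //; rewrite modulus_real. Qed.

Lemma moduli_between t :
  (ereal_sup lower < t%:E)%E -> (t%:E < ereal_inf upper)%E -> moduli t%:E.
Proof.
have [a [a0 supE _]] := lower_sup; rewrite supE lte_fin => at_ tb.
have t0 := le_lt_trans a0 at_.
apply: (moduli_real (ltW t0)); apply: exceptional_real => Ct.
  move: tb; rewrite ltNge => /negP; apply; apply: ereal_inf_lbound.
  by exists t.
move: at_; rewrite -lte_fin ltNge -supE => /negP; apply; apply: ereal_sup_ubound.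
by exists t => //; split=> //; exact: ltW.
Qed.

(** Here no real [t] lies strictly between the bounds, so [moduli_between] gives nothing. But then
    [y = a *: x], and [a] is exceptional because the difference is the zero vector, which is removed
    from the complex cone. *)
Lemma moduli_degenerate : (ereal_inf upper <= ereal_sup lower)%E ->
  ereal_inf upper = ereal_sup lower /\ moduli (ereal_sup lower).
Proof.
have [a [a0 supE Ca]] := lower_sup; rewrite supE => ba.
have -> : ereal_inf upper = a%:E.
  apply: le_anti; rewrite ba /=; apply: le_ereal_inf_tmp => _ [t [_ Ct] <-].
  by rewrite lee_fin; exact: cone_le Ct.
split=> //; apply: moduli_real => //; apply: exceptional_scale => //.
apply: cone_eq_scale => //; apply: upper_attained; apply: le_anti; rewrite ba /=.
apply: le_ereal_inf_tmp => _ [t [_ Ct] <-].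
by rewrite lee_fin; exact: cone_le Ct.
Qed.

Lemma ereal_sup_moduli : ereal_sup moduli = ereal_inf upper.
Proof.
apply: le_anti; apply/andP; split.
  apply: ge_ereal_sup => _ [z Ez <-]; apply: le_ereal_inf_tmp => _ [t [t0 Ct] <-].
  by rewrite lee_fin; exact: exceptional_le Ez.
have [ba|ab] := leP (ereal_inf upper) (ereal_sup lower).
  by have [-> ?] := moduli_degenerate ba; exact: ereal_sup_ubound.
rewrite leNgt; apply/negP => mb.
have [a [a0 supE _]] := lower_sup.
(* Taking the maximum with [a] places the chosen [t] above the lower bound as well, as
   [moduli_between] requires. *)
have : (Order.max (ereal_sup moduli) a%:E < ereal_inf upper)%E.
  by rewrite gt_max mb -supE.
case E0 : (Order.max _ _) => [r| |]; last 2 first.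
- by rewrite ltNge leey.
- by have : (a%:E <= -oo)%E by rewrite -E0 le_max lexx orbT.
move=> /ereal_right_dense[t rt tb].
have mt : (Order.max (ereal_sup moduli) a%:E < t%:E)%E by rewrite E0 lte_fin.
move: mt; rewrite gt_max => /andP[mt at_].
have : moduli t%:E by apply: moduli_between => //; rewrite supE.
by move=> /ereal_sup_ubound; rewrite leNgt mt.
Qed.

Lemma ereal_inf_moduli : ereal_inf moduli = ereal_sup lower.
Proof.
apply: le_anti; apply/andP; split; last first.
  apply: ge_ereal_sup => _ [t [t0 Ct] <-]; apply: le_ereal_inf_tmp => _ [z Ez <-].
  by rewrite lee_fin; exact: exceptional_ge Ez.
have [ba|ab] := leP (ereal_inf upper) (ereal_sup lower).
  by have [_ ?] := moduli_degenerate ba; exact: ereal_inf_lbound.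
rewrite leNgt; apply/negP => am.
have : (ereal_sup lower < Order.min (ereal_inf moduli) (ereal_inf upper))%E.
  by rewrite lt_min am.
have [a [a0 supE _]] := lower_sup; rewrite supE => /ereal_right_dense[t at_].
rewrite lt_min => /andP[tm tb].
have : moduli t%:E by apply: moduli_between => //; rewrite supE.
by move=> /ereal_inf_lbound; rewrite leNgt tm.
Qed.

Lemma projective_metric_incl :
  projective_metric (CC `\ 0) (incl x) (incl y) = hilbert_metric C x y.
Proof. by rewrite /projective_metric ereal_sup_moduli ereal_inf_moduli. Qed.

(** A finite distance forces [alpha > 0] and [beta] finite. Both are attained since [C] is closed,
    and [beta <= expR D * alpha], so [a] is [alpha]. *)
Lemma hilbert_metric_le (D : R) : (hilbert_metric C x y <= D%:E)%E ->
  exists a, [/\ 0 < a, C (y - a *: x) & C ((expR D * a) *: x - y)].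
Proof.
have [a [a0 supE Ca]] := lower_sup; rewrite /hilbert_metric /log_ratio supE.
case: ifPn => [_|]; first by rewrite leye_eq.
rewrite negb_or eqe => /andP[].
case infE : (ereal_inf _) => [b| |]// _ an0; last first.
  have : (0 <= ereal_inf upper)%E.
    by apply: le_ereal_inf_tmp => _ [t [t0 _] <-]; rewrite lee_fin ltW.
  by rewrite infE.
have Cb := upper_attained infE.
have {an0} a0' : 0 < a by rewrite lt_neqAle eq_sym an0.
have b0 : 0 < b by rewrite (lt_le_trans a0')//; exact: cone_le Cb.
rewrite inver gt_eqF// -EFinM lne_EFin ?divr_gt0// lee_fin => lnD.
exists a; split=> //; apply: cone_upward Cb.
by rewrite -ler_pdivrMr// -ler_ln ?posrE ?expR_gt0 ?divr_gt0// expRK.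
Qed.

End TwoVectors.
End HilbertMetric.

(** * Complex functionals on the real cone and the contraction estimate *)

Section ConeFunctional.
Variables (R : realType) (V : completeNormedModType R) (C : set V).
Hypotheses (C_closed : closed C) (C_cone : convex_cone C).
Hypothesis C_proper : proper_cone C.
Local Notation CC := (canonical_complexification C).
Local Notation modulus z := (complex.Re `|z|).

Definition cone_functional (f : V -> R[i]) : Prop :=
  [/\ forall u v, f (u + v) = f u + f v,
      forall (t : R) u, f (t *: u) = t%:C%C * f u &
      forall u v, C u -> C v -> 0 <= complex.Re (f u * (f v)^*%C)].

Definition functional_ext (f : V -> R[i]) (x : complexification V) : R[i] :=
  f x.1 + 'i%C * f x.2.

Lemma cone_functionalB f u v : cone_functional f -> f (u - v) = f u - f v.
Proof.
move=> [fD fZ _]; rewrite fD -scaleN1r fZ.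
by rewrite rmorphN1 mulN1r.
Qed.

Lemma functional_extZ f z x :
  cone_functional f -> functional_ext f (z *: x) = z * functional_ext f x.
Proof.
move=> Cf; case: (Cf) => fD fZ _; rewrite /functional_ext /= cone_functionalB// fD !fZ.
case: z (f _) (f _) => [a b] [p q] [p' q'] /=.
by apply/eqP; rewrite eq_complex /=; apply/andP; split; apply/eqP; ring.
Qed.

(** The real part expands to [l1 u l1 v + |mu|^2 l2 u l2 v + Re mu (l1 u l2 v + l2 u l1 v)], in
    which every term is nonnegative. *)
Lemma cone_functional_comb l1 l2 (mu : R[i]) :
  dual_cone C l1 -> dual_cone C l2 -> 0 <= complex.Re mu ->
  cone_functional (fun u => (l1 u)%:C%C + mu * (l2 u)%:C%C).
Proof.
case: mu => m n /= [_ D1] [_ D2] m0; split=> [u v|t u|u v Cu Cv].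
- rewrite !linearD /=; apply/eqP; rewrite eq_complex /=.
  by apply/andP; split; apply/eqP; ring.
- rewrite !linearZ /=; apply/eqP; rewrite eq_complex /=.
  by apply/andP; split; apply/eqP; ring.
- rewrite Re_mul_conj /=.
  set L := (X in 0 <= X); suff -> : L = l1 u * l1 v + (m ^+ 2 + n ^+ 2) * (l2 u * l2 v)
      + m * (l1 u * l2 v + l2 u * l1 v).
    by rewrite !addr_ge0// ?mulr_ge0 ?addr_ge0 ?sqr_ge0 ?mulr_ge0 ?D1 ?D2.
  by rewrite /L; ring.
Qed.

Lemma functional_ext_comb (l1 l2 : {scalar V}) (mu : R[i]) x :
  functional_ext (fun u => (l1 u)%:C%C + mu * (l2 u)%:C%C) x =
  scalar_ext l1 x + mu * scalar_ext l2 x.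
Proof.
case: mu => m n; apply/eqP; rewrite eq_complex /=.
by apply/andP; split; apply/eqP; ring.
Qed.

(* Positivity of [Re (f u * conj (f v))] for [u = b - s a], [v = t a - b]
   says that [f b / f a] lies in the closed disc with diameter [s, t]. *)
Lemma cone_functional_disc f a b s t : cone_functional f -> s <= t ->
  C (b - s *: a) -> C (t *: a - b) ->
  modulus (f b - ((t + s) / 2)%:C%C * f a) <= (t - s) / 2 * modulus (f a).
Proof.
move=> Cf st Cs Ct; have [_ fZ fC] := Cf.
have := modulus_subr_le_addr (fC _ _ Cs Ct).
rewrite !cone_functionalB// !fZ.
have -> : f b - s%:C%C * f a - (t%:C%C * f a - f b) =
    2%:C%C * (f b - ((t + s) / 2)%:C%C * f a).
  case: (f a) (f b) => [p q] [p' q'].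
  by apply/eqP; rewrite eq_complex /=; apply/andP; split; apply/eqP; field.
have -> : f b - s%:C%C * f a + (t%:C%C * f a - f b) = (t - s)%:C%C * f a.
  case: (f a) (f b) => [p q] [p' q'].
  by apply/eqP; rewrite eq_complex /=; apply/andP; split; apply/eqP; ring.
rewrite !modulusM !modulus_real ?subr_ge0// => le; lra.
Qed.

Section BoundedSet.
Variables (K : set V) (M : R).
Hypotheses (KC : K `<=` C `\ 0) (K0 : K !=set0) (M1 : 1 <= M).
Hypothesis K_bounded : forall a b, K a -> K b ->
  exists s, [/\ 0 < s, C (b - s *: a) & C ((M * s) *: a - b)].

Definition complex_span : set (complexification V) :=
  [set p | exists z u v, [/\ z != 0, K u \/ u = 0, K v \/ v = 0,
    ~ (u = 0 /\ v = 0) & p = z *: ((u, v) : complexification V)]].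

Let M0 : 0 < M. Proof. exact: lt_le_trans M1. Qed.

(** The disc with diameter [[s, M s]] lies in the annulus with these radii. The point is that [s] is
    chosen before [f]. *)
Lemma bounded_functional_ratio a b : K a -> K b -> exists2 s, 0 < s &
  forall f, cone_functional f ->
    s * modulus (f a) <= modulus (f b) <= M * s * modulus (f a).
Proof.
move=> Ka Kb; have [s [s0 C1 C2]] := K_bounded Ka Kb; exists s => // f Cf.
have sM : s <= M * s by rewrite ler_peMl// ltW.
have := modulus_annulus (cone_functional_disc Cf sM C1 C2).
rewrite modulus_real; last by rewrite divr_ge0// addr_ge0// ltW// mulr_gt0.
by move: (modulus _) (modulus _) => X Y /andP[? ?]; apply/andP; split; lra.
Qed.

Lemma complex_span_ratio x : complex_span x -> exists a m, [/\ K a, 0 < m &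
  forall f, cone_functional f ->
    m * modulus (f a) <= modulus (functional_ext f x) <= M * m * modulus (f a)].
Proof.
move=> [z [u [v [z0 Ku Kv uv ->]]]].
have mz0 : 0 < modulus z by rewrite modulus_gt0.
have one a (f : V -> R[i]) : modulus z * modulus (f a) <= modulus z * modulus (f a) <=
    M * modulus z * modulus (f a).
  by rewrite lexx -mulrA ler_peMl // mulr_ge0 ?modulus_ge0.
have f0 f : cone_functional f -> f 0 = 0.
  by move=> /(cone_functionalB 0 0); rewrite !subrr.
case: Ku Kv uv => [Ku|->] [Kv|->] uv; last by case: uv.
- have [s [s0 C1 C2]] := K_bounded Ku Kv.
  have sM : s <= M * s by rewrite ler_peMl// ltW.
  have Ms0 : 0 < M * s by rewrite mulr_gt0.
  pose c := (M * s + s) / 2; pose r := (M * s - s) / 2.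
  (* The quotient [f (u + i v) / f u = 1 + i (f v / f u)] lies in the disc with centre [k = 1 + i c]
     and radius [r]. *)
  pose k : R[i] := Complex 1 c.
  have c0 : 0 < c by rewrite divr_gt0// addr_gt0.
  have ck : c < modulus k.
    by rewrite -ltr_sqr ?nnegrE ?modulus_ge0 ?(ltW c0)// modulus_sqr /= ltrDr expr1n.
  have rk : 0 < modulus k - r by move: ck; rewrite subr_gt0 /c /r; lra.
  (* As [(M + 1) r = (M - 1) c], the difference of the two sides is [(M - 1) (|k| - c)], and
     [|k| > c]. So the shift by [1] does not worsen the ratio [M]. *)
  have krM : modulus k + r <= M * (modulus k - r).
    rewrite -subr_ge0 (_ : _ - _ = (M - 1) * (modulus k - c)).
      by rewrite mulr_ge0 ?subr_ge0// ltW.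
    by rewrite /c /r; field.
  exists u, (modulus z * (modulus k - r)); split=> //; first exact: mulr_gt0.
  move=> f Cf; rewrite functional_extZ// modulusM.
  have : modulus (functional_ext f (u, v) - k * f u) <= r * modulus (f u).
    have := cone_functional_disc Cf sM C1 C2; rewrite -/c -/r.
    have -> : functional_ext f (u, v) - k * f u = 'i%C * (f v - c%:C%C * f u).
      rewrite /functional_ext /=; case: (f u) (f v) => [p q] [p' q'].
      by apply/eqP; rewrite eq_complex /=; apply/andP; split; apply/eqP; ring.
    by rewrite modulusM modulus_i mul1r.
  move=> /modulus_annulus /andP[lo hi]; apply/andP; split.
    by rewrite -mulrA ler_pM2l.
  rewrite [M * _]mulrCA -mulrA ler_pM2l//.
  by apply: le_trans hi _; rewrite ler_wpM2r// modulus_ge0.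
- exists u, (modulus z); split=> // f Cf; rewrite functional_extZ// modulusM.
  by rewrite /functional_ext /= f0// mulr0 addr0; exact: one.
- exists v, (modulus z); split=> // f Cf; rewrite functional_extZ// modulusM.
  have -> : functional_ext f (0, v) = 'i%C * f v.
    by rewrite /functional_ext f0// add0r.
  by rewrite modulusM modulus_i mul1r; exact: one.
Qed.

Lemma complex_span_annulus p q : complex_span p -> complex_span q ->
  exists2 m, 0 < m & forall z f, cone_functional f ->
    (forall a, K a -> f a != 0) -> functional_ext f q = z * functional_ext f p ->
    m <= modulus z <= M ^+ 3 * m.
Proof.
move=> /complex_span_ratio[a [m [Ka m0 fp]]] /complex_span_ratio[b [n [Kb n0 fq]]].
have [s s0 fab] := bounded_functional_ratio Ka Kb.
(* Relative to [f], the factors [f q / f b], [f b / f a] and [f p / f a] have moduli in [[n, M n]],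
   [[s, M s]] and [[m, M m]]. The extreme values of their combination differ by the factor
   [M ^+ 3]. *)
exists (n * s / (M * m)); first by rewrite divr_gt0 ?mulr_gt0.
move=> z f Cf fK fE; have fa : 0 < modulus (f a) by rewrite modulus_gt0 fK.
have := fp f Cf; have := fq f Cf; have := fab f Cf; rewrite fE modulusM.
have := modulus_ge0 z; set X := modulus (functional_ext _ _).
move: (modulus z) (modulus (f a)) (modulus (f b)) X fa => w A B X A0 w0.
move=> /andP[AB BA] /andP[wX Xw] /andP[AX XA].
apply/andP; split.
  rewrite ler_pdivrMr ?mulr_gt0// -(ler_pM2r A0).
  have : n * (s * A) <= w * (M * m * A).
    rewrite (le_trans (ler_wpM2l (ltW n0) AB))// (le_trans wX)//.
    exact: ler_wpM2l.
  by rewrite !mulrA.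
have -> : M ^+ 3 * (n * s / (M * m)) = M * n * (M * s) / m.
  by field; rewrite !gt_eqF.
rewrite ler_pdivlMr// -(ler_pM2r A0) -!mulrA.
rewrite (le_trans (ler_wpM2l w0 AX))// (le_trans Xw)// -!mulrA !ler_pM2l//.
by rewrite mulrA.
Qed.

(** Elements of [K] are comparable: [0 <= l b <= M s l a], so a zero of [l] at one point of [K]
    spreads to all of [K]. *)
Lemma dual_cone_vanish l a : dual_cone C l -> K a -> l a = 0 ->
  forall p, complex_span p -> scalar_ext l p = 0.
Proof.
move=> [_ Dl] Ka la.
have lK b : K b \/ b = 0 -> l b = 0.
  case=> [Kb|->]; last exact: linear0.
  have [s [s0 _ C2]] := K_bounded Ka Kb; have := Dl _ C2.
  rewrite linearB linearZ /= la mulr0 sub0r oppr_ge0 => lb.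
  by apply: le_anti; rewrite lb Dl//; case: (KC Kb).
move=> _ [z [u [v [_ Ku Kv _ ->]]]].
have luv : scalar_ext l (u, v) = 0 by rewrite /scalar_ext /= !lK.
transitivity (z * scalar_ext l (u, v)); first exact: linearZ.
by rewrite luv mulr0.
Qed.

Lemma exceptional_functional p q z : complex_span p -> complex_span q ->
  exceptional_set (CC `\ 0) p q z ->
  exists f, [/\ cone_functional f, forall a, K a -> f a != 0 &
    functional_ext f q = z * functional_ext f p].
Proof.
move=> Sp Sq Ez; have [pq|w0] := pselect (z *: p - q = 0).
  have [a Ka] := K0; have [Ca a0] := KC Ka.
  have [l Dl la] := dual_cone_gt0 C_closed C_cone C_proper Ca a0.
  have Cf := cone_functional_comb (mu := 0) Dl Dl (lexx 0).
  exists (fun u => (l u)%:C%C + 0 * (l u)%:C%C); split=> // [b Kb|].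
    rewrite mul0r addr0 eq_complex /= eqxx andbT gt_eqF//.
    have [s [s0 C1 _]] := K_bounded Ka Kb; have := Dl.2 _ C1.
    by rewrite linearB linearZ /= subr_ge0; apply: lt_le_trans; rewrite mulr_gt0.
  by move/eqP: pq; rewrite subr_eq0 => /eqP <-; rewrite functional_extZ.
have [l1 [l2 [D1 D2]]] : exists l1 l2, [/\ dual_cone C l1, dual_cone C l2 &
    complex.Re (scalar_ext l1 (z *: p - q) * (scalar_ext l2 (z *: p - q))^*%C) < 0].
  apply: contrapT => nl; apply: Ez; split=> // l1 l2 D1 D2.
  by rewrite leNgt; apply/negP => lt; apply: nl; exists l1, l2.
set w := z *: p - q; set X := scalar_ext l1 w; set Y := scalar_ext l2 w => XY.
have X0 : X != 0.
  by apply: contraTneq XY => ->; rewrite mul0r ltxx.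
have Y0 : Y != 0.
  by apply: contraTneq XY => ->; rewrite conjc0 mulr0 ltxx.
have vanish l : dual_cone C l -> scalar_ext l w != 0 -> forall a, K a -> 0 < l a.
  move=> Dl lw a Ka; rewrite lt_neqAle Dl.2 ?andbT; last by case: (KC Ka).
  apply: contraNneq lw => /esym la; rewrite linearB linearZ /=.
  by rewrite !(dual_cone_vanish Dl Ka la)// mulr0 subrr.
(* This [mu] makes [l1 + mu l2] vanish at [w], and [Re mu > 0] because [Re (X * conj Y) < 0]. Since
   [X] and [Y] are nonzero, [l1] and [l2] are positive on [K], hence so is the real part of the
   combination. *)
have [mu Xmu] : exists mu, X = - (mu * Y).
  by exists (- (X / Y)); rewrite mulNr opprK divfK.
have mu0 : 0 <= complex.Re mu.
  move: XY Y0; rewrite Xmu; move: (Y); case: (mu) => [m n] [c d].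
  rewrite eq_complex negb_and Re_mul_conj /= => + cd.
  rewrite [X in X < 0](_ : _ = - (m * (c ^+ 2 + d ^+ 2))); last by ring.
  rewrite oppr_lt0 pmulr_lgt0; first exact: ltW.
  by rewrite lt_neqAle addr_ge0 ?sqr_ge0// andbT eq_sym paddr_eq0 ?sqr_ge0// !sqrf_eq0 negb_and.
have Cf := cone_functional_comb D1 D2 mu0.
exists (fun u => (l1 u)%:C%C + mu * (l2 u)%:C%C); split=> // [a Ka|].
  have l1a := vanish _ D1 X0 _ Ka; have l2a := vanish _ D2 Y0 _ Ka.
  rewrite eq_complex negb_and; apply/orP; left; rewrite gt_eqF//.
  case: (mu) mu0 => m n /= m0; rewrite mulr0 subr0.
  by rewrite ltr_pwDl// mulr_ge0// ltW.
rewrite -functional_extZ// !functional_ext_comb; apply/eqP.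
rewrite eq_sym -subr_eq0 opprD addrACA -mulrBr -!linearB /=.
by rewrite -/w -/X -/Y Xmu addNr.
Qed.

End BoundedSet.
End ConeFunctional.

(** * From the annulus to the diameter bound, and the theorem *)

Lemma log_ratio_le (R : realType) (S : set R) (m L : R) : 0 < m ->
  (forall t, S t -> m <= t <= expR L * m) ->
  (log_ratio (ereal_sup (EFin @` S)) (ereal_inf (EFin @` S)) <= L%:E)%E.
Proof.
move=> m0 St.
have : (ereal_sup (EFin @` S) <= (expR L * m)%:E)%E.
  by apply: ge_ereal_sup => _ [t /St/andP[_ ?] <-]; rewrite lee_fin.
have : (m%:E <= ereal_inf (EFin @` S))%E.
  by apply: le_ereal_inf_tmp => _ [t /St/andP[? _] <-]; rewrite lee_fin.
have lne_le r : r <= expR L -> (lne r%:E <= L%:E)%E.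
  move=> rL; have [r0|r0] := leP r 0; first by rewrite le0_lneNy ?lee_fin// leNye.
  by rewrite lne_EFin// lee_fin -ler_expR lnK.
(* [S] may be empty; the default values [-oo] and [+oo] then give quotient [0], whose logarithm is
   [-oo]. *)
rewrite /log_ratio; case: (ereal_sup _) (ereal_inf _) => [b| |] [a| |]//=;
  rewrite ?lee_fin ?leye_eq ?leeNy_eq// => ma bm.
- have a0 := lt_le_trans m0 ma; rewrite eqe gt_eqF// inver gt_eqF//.
  rewrite -EFinM; apply: lne_le; rewrite ler_pdivrMr// (le_trans bm)//.
  by rewrite ler_wpM2l// expR_ge0.
- by rewrite mulr0 lexx leNye.
- have a0 := lt_le_trans m0 ma; rewrite eqe gt_eqF// inver gt_eqF//.
  by rewrite gt0_mulNye ?lte_fin ?invr_gt0// leNye.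
- by rewrite invey mule0; apply: lne_le; exact: expR_ge0.
Qed.

(** The decomposition [x = z (u + i v)] is carried over by complex linearity; [P] kills no nonzero
    vector of [C], so the two image parts do not both vanish. *)
Lemma linear_ext_complex_span (R : realType) (V : completeNormedModType R)
    (C : set V) (P : {linear V -> V}) x :
  closed C -> convex_cone C -> proper_cone C ->
  P @` (C `\ 0) `<=` C `\ 0 ->
  (canonical_complexification C `\ 0) x ->
  complex_span (P @` (C `\ 0)) (linear_ext P x).
Proof.
move=> Ccl Cc Cp PC [/(CC_decomp Ccl Cc Cp)[z [u [v [z0 Cu Cv ->]]]] uv0].
have PK w : C w -> (P @` (C `\ 0)) (P w) \/ P w = 0.
  move=> Cw; have [->|w0] := pselect (w = 0); first by right; exact: linear0.
  by left; exists w.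
have Pker w : C w -> P w = 0 -> w = 0.
  move=> Cw Pw0; apply: contrapT => w0.
  by have [] : (C `\ 0) (P w) by apply: PC; exists w.
exists z, (P u), (P v); split; [exact: z0|exact: PK|exact: PK| |exact: linearZ].
move=> [/(Pker _ Cu) u0 /(Pker _ Cv) v0]; apply: uv0.
by rewrite u0 v0; exact: scaler0.
Qed.

Lemma hilbert_bounded_diameter (R : realType) (V : completeNormedModType R)
    (C K : set V) (d : R) :
  closed C -> convex_cone C -> proper_cone C -> K `<=` C `\ 0 ->
  (diameter (hilbert_metric C) K <= d%:E)%E ->
  forall a b, K a -> K b ->
    exists s, [/\ 0 < s, C (b - s *: a) & C ((expR d * s) *: a - b)].
Proof.
move=> Ccl Cc Cp KC Kd a b Ka Kb; have [Ca a0] := KC _ Ka; have [Cb b0] := KC _ Kb.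
apply: (hilbert_metric_le Ccl Cc Cp Ca a0 Cb) => //; apply: le_trans Kd.
by apply: ereal_sup_ubound; exists a => //; exists b.
Qed.

Unset Implicit Arguments.

Theorem theorem4p3 (R : realType) (V : completeNormedModType R) (C : set V)
    (C_closed : closed C) (C_cone : convex_cone C) (C_proper : proper_cone C)
    (C_indep : has_two_independent C)
    (P : {linear V -> V})
    (P_cone : forall x, (C `\ 0) x -> (C `\ 0) (P x)) :
  let CR : set V := C `\ 0 in
  let CC : set (complexification V) := canonical_complexification C `\ 0 in
  let h := hilbert_metric C in
  let delta := projective_metric CC in
  isometric_embedding CR h CC delta (@complexification_incl R V) /\
  ((forall x, CC x -> CC (linear_ext P x)) /\
   (diameter delta (linear_ext P @` CC) <= 3%:E * diameter h (P @` CR))%E).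
Proof.
move=> CR CC h delta; split.
  split=> [x [Cx x0]|x y _ _ []//|x y [Cx x0] [Cy y0]].
    by split; [exact: CC_intro Cx (proper_cone0 C_proper)|move=> [] /x0].
  exact: projective_metric_incl.
set K := P @` CR.
have KC : K `<=` C `\ 0 by move=> _ [x Cx <-]; exact: P_cone.
have Pspan x : CC x -> complex_span K (linear_ext P x).
  exact: linear_ext_complex_span.
have KC0 u : K u \/ u = 0 -> C u.
  by case=> [/KC[]//|->]; exact: proper_cone0 C_proper.
split=> [x /Pspan[z [u [v [z0 /KC0 Cu /KC0 Cv uv ->]]]]|].
  split; first exact/CC_scale/CC_intro.
  move=> /= /eqP; rewrite scaler_eq0 (negbTE z0) /= => /eqP[u0 v0].
  exact: uv.
have [a Ka] : K !=set0.
  have [u [v [Cu _ uv]]] := C_indep; exists (P u), u => //; split=> // u0.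
  have [] := uv 1 0; first by rewrite u0 scaler0 scale0r addr0.
  by move=> /eqP; rewrite oner_eq0.
have [Ca a0] := KC _ Ka.
have bounded d := hilbert_bounded_diameter (d := d) C_closed C_cone C_proper KC.
(* Comparing [a] with itself gives [s <= 1 <= expR d * s]. *)
have expd d : (diameter h K <= d%:E)%E -> 1 <= expR d.
  move=> /bounded /(_ _ _ Ka Ka)[s [s0]].
  rewrite -{1}[a]scale1r -scalerBl => /(cone_scale_eq0 C_closed C_cone C_proper Ca a0).
  rewrite subr_ge0 => s1.
  rewrite -{2}[a]scale1r -scalerBl => /(cone_scale_eq0 C_closed C_cone C_proper Ca a0).
  by rewrite subr_ge0 => /le_trans; apply; rewrite ler_piMr// expR_ge0.
case Kd : (diameter h K) => [d| |]; last 2 first.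
- by rewrite gt0_muley ?lte_fin// leey.
(* A diameter [-oo] would be bounded by [-1], giving [1 <= expR (-1)]. *)
- by have := expd (-1); rewrite Kd leNye => /(_ isT); rewrite leNgt expR_lt1 oppr_lt0 ltr01.
have Kled : (diameter h K <= d%:E)%E by rewrite Kd.
apply: ge_ereal_sup => _ [_ [x CCx <-] [_ [y CCy <-] <-]].
(* [m] is fixed here, before [z] and the functional that depends on it, so one annulus contains the
   whole exceptional set. *)
have [m m0 mP] := complex_span_annulus (expd d Kled) (bounded d Kled)
  (Pspan _ CCx) (Pspan _ CCy).
rewrite /delta /projective_metric -EFinM.
set E := exceptional_set _ _ _.
have -> : [set (complex.Re `|z|)%:E | z in E] = EFin @` [set complex.Re `|z| | z in E].
  by rewrite image_comp.
apply: (log_ratio_le m0) => _ [z Ez <-].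
have [f [Cf fK fE]] := exceptional_functional C_closed C_cone C_proper KC
  (ex_intro _ a Ka) (bounded d Kled) (Pspan _ CCx) (Pspan _ CCy) Ez.
by rewrite expRM_natl; exact: mP fE.
Qed.
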